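(* For any reported vector of privacy sensitivities $(c_1,\dots,c_n)$, the optimal value of the local privacy optimization problem $$\min_{\mathbf y\in[0,\infty)^n}\ \frac{n+1}{\sum_{i=1}^n\frac{1}{\mathrm{VAR}+\frac{2}{y_i^2}}}+\sum_{i=1}^n\psi_i(c_i)\,y_i$$ is not smaller than the optimal value of the central privacy optimization problem $$\min_{\mathbf y\in[0,\infty)^n}\ \frac{n+1}{\left(\sum_{j=1}^n y_j\right)^2}\Big(2+\sum_{i=1}^n y_i^2\,\mathrm{VAR}\Big)+\sum_{i=1}^n\psi_i(c_i)\,y_i .$$
   Context: Convention: $\frac{1}{\mathrm{VAR}+2/y^2}=0$ when $y=0$; division by zero of a positive number gives $+\infty$; optimal values are infima. $\mathrm{VAR}$ is the variance of the users' data and $\psi_i(c)=c+\frac{F_i(c)}{f_i(c)}\ge0$ is the virtual cost of user $i$, where $F_i$ and $f_i$ are the CDF and density of the privacy sensitivity of user $i$, and $c_i\geq 0$ with $f_i(c_i)\ne0$. *)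

(* Defs.v *)
From HB Require Import structures.
From mathcomp Require Import all_boot all_order all_algebra.
From mathcomp Require Import all_classical all_reals all_analysis.

Set Implicit Arguments.
Unset Strict Implicit.
Unset Printing Implicit Defensive.

Import Order.TTheory GRing.Theory Num.Theory.
Import numFieldNormedType.Exports.

Local Open Scope classical_set_scope.
Local Open Scope ring_scope.

(* Density with respect to the Lebesgue measure, in its everywhere-nonnegative
   version. *)
Definition is_density (d : measure_display) (T : measurableType d)
    (R : realType) (P : probability T R) (X : {RV P >-> R}) (f : R -> R) : Prop :=
  [/\ measurable_fun [set: R] f,
      forall x, 0 <= f x &
      forall A : set R, measurable A ->
        distribution P X A = (\int[lebesgue_measure]_(x in A) (f x)%:E)%E].

(* [fine] loses nothing here: a cdf takes its values in [0, 1]. *)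
Definition virtual_cost (d : measure_display) (T : measurableType d)
    (R : realType) (P : probability T R) (C : {RV P >-> R}) (f : R -> R)
    (c : R) : R :=
  c + fine (cdf C c) / f c.

Definition nonneg_orthant (R : realType) (n : nat) : set ('I_n -> R) :=
  [set y | forall i, 0 <= y i].

(* The quotients below are taken in \bar R, where the inverse satisfies
   0^-1 = +oo and +oo^-1 = 0.  Hence (VAR + 2 / y^2)^-1 = 0 at y = 0, and a
   positive number divided by 0 is +oo. *)
Definition local_objective (R : realType) (n : nat) (VAR : R)
    (psi y : 'I_n -> R) : \bar R :=
  ((n.+1)%:R%:E / (\sum_(i < n) (VAR%:E + 2%:E / (y i ^+ 2)%:E)^-1)
   + (\sum_(i < n) psi i * y i)%:E)%E.

Definition central_objective (R : realType) (n : nat) (VAR : R)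
    (psi y : 'I_n -> R) : \bar R :=
  ((n.+1)%:R%:E / ((\sum_(j < n) y j) ^+ 2)%:E
     * (2 + \sum_(i < n) y i ^+ 2 * VAR)%:E
   + (\sum_(i < n) psi i * y i)%:E)%E.

Definition optimal_value (R : realType) (n : nat)
    (obj : ('I_n -> R) -> \bar R) : \bar R :=
  ereal_inf (obj @` @nonneg_orthant R n).

(* Main.v *)
Require Import Defs.
From HB Require Import structures.
From mathcomp Require Import all_boot all_order all_algebra.
From mathcomp Require Import all_classical all_reals all_analysis.
From mathcomp Require Import ring.

Import Order.TTheory GRing.Theory Num.Theory.
Import numFieldNormedType.Exports.

Local Open Scope classical_set_scope.
Local Open Scope ring_scope.

(** A local budget vector [y] gives user [i] the estimation weight
    [w_i = y_i^2 / (V y_i^2 + 2)], and the local error is [(n+1) / sum w].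
    The central mechanism need not be run at [y] itself, where it may be worse.
    It is run at [z_i = w_i / m], with [m] the largest of the ratios
    [r_i = w_i / y_i = y_i / (V y_i^2 + 2)].  Then [z <= y], so the payments do
    not increase, and since [w_i = V w_i^2 + 2 r_i^2], summing gives
    [V * sum w^2 + 2 m^2 <= sum w], so the central error at [z] is at most
    [(n+1) / sum w]. *)

Lemma virtual_cost_ge0 (d : measure_display) (T : measurableType d)
    (R : realType) (P : probability T R) (C : {RV P >-> R}) (f : R -> R)
    (c : R) : 0 <= c -> 0 <= f c -> 0 <= virtual_cost C f c.
Proof.
by move=> c0 fc0; rewrite addr_ge0// divr_ge0// fine_ge0// cdf_ge0.
Qed.

Lemma central_budget (R : realFieldType) (n : nat) (V : R) (y : 'I_n -> R) :
  0 <= V -> (forall i, 0 <= y i) -> (exists i, y i != 0) ->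
  let S := \sum_(i < n) y i ^+ 2 / (V * y i ^+ 2 + 2) in
  exists z : 'I_n -> R,
    [/\ forall i, 0 <= z i <= y i, 0 < \sum_(i < n) z i, 0 < S &
        (2 + \sum_(i < n) z i ^+ 2 * V) / (\sum_(i < n) z i) ^+ 2 <= S^-1].
Proof.
move=> V0 y0 [k yk] S.
have D0 i : 0 < V * y i ^+ 2 + 2 by rewrite ltr_wpDl// mulr_ge0// sqr_ge0.
pose w i := y i ^+ 2 / (V * y i ^+ 2 + 2).
pose r i := y i / (V * y i ^+ 2 + 2).
have w0 i : 0 <= w i by rewrite divr_ge0 ?sqr_ge0// ltW.
have r0 i : 0 <= r i by rewrite divr_ge0// ltW.
have wr i : w i = y i * r i by rewrite [RHS]mulrA -expr2.
(* Expand [w i] by its own denominator: [y^2 / D = y^2 (V y^2 + 2) / D^2]. *)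
have wE i : w i = w i ^+ 2 * V + 2 * r i ^+ 2.
  by rewrite /w /r; field; exact: lt0r_neq0.
have [j _ rj] := @arg_maxP _ _ _ k xpredT r isT.
have m0 : 0 < r j.
  by apply: lt_le_trans (rj k isT); rewrite divr_gt0// lt_def yk y0.
have S0 : 0 < S.
  rewrite /S (bigD1 k)//= ltr_pwDl//; last by apply: sumr_ge0 => i _; exact: w0.
  by rewrite divr_gt0// exprn_gt0// lt_def yk y0.
have sumz : \sum_(i < n) w i / r j = S / r j by rewrite -mulr_suml.
have sumz2 : \sum_(i < n) (w i / r j) ^+ 2 * V
    = (\sum_(i < n) w i ^+ 2 * V) / r j ^+ 2.
  by rewrite mulr_suml; apply: eq_bigr => i _; rewrite expr_div_n mulrAC.
(* Sum [wE] over all users and keep, of the nonnegative terms [2 * r i ^+ 2], only the one at the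
   maximiser [j]. *)
have key : \sum_(i < n) w i ^+ 2 * V + 2 * r j ^+ 2 <= S.
  rewrite /S (eq_bigr _ (fun i _ => wE i)) big_split/= lerD2l.
  by rewrite (bigD1 j)//= lerDl sumr_ge0// => i _; rewrite mulr_ge0// sqr_ge0.
have Sr0 : 0 < S / r j by exact: divr_gt0.
exists (fun i => w i / r j); split => //.
- by move=> i; rewrite divr_ge0//= ler_pdivrMr// wr ler_wpM2l//; exact: rj.
- by rewrite sumz.
rewrite sumz sumz2 ler_pdivrMr ?exprn_gt0//.
have -> : S^-1 * (S / r j) ^+ 2 = S / r j ^+ 2.
  by field; rewrite !lt0r_neq0.
by rewrite ler_pdivlMr ?exprn_gt0// mulrDl mulfVK ?expf_neq0 ?lt0r_neq0// addrC.
Qed.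

(** Turns the extended-real weights into real ones: at [x = 0] the convention gives the inverse of
    [+oo], which is 0 and agrees with the real quotient [0 / 2]. *)
Lemma local_weightE (R : realType) (V x : R) : 0 <= V ->
  ((V%:E + 2%:E / (x ^+ 2)%:E)^-1 = (x ^+ 2 / (V * x ^+ 2 + 2))%:E)%E.
Proof.
move=> V0; have [->|x0] := eqVneq x 0.
  by rewrite expr0n/= mul0r inver eqxx gt0_muley ?lte_fin// addey// invey.
have x20 : 0 < x ^+ 2 by rewrite lt_def expf_neq0 ?sqr_ge0.
have D0 : 0 < V * x ^+ 2 + 2 by rewrite ltr_wpDl// mulr_ge0// ltW.
have VE : V + 2 / x ^+ 2 = (V * x ^+ 2 + 2) / x ^+ 2.
  by field.
rewrite inver gt_eqF// -EFinM -EFinD VE inver gt_eqF ?divr_gt0//.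
by rewrite invf_div.
Qed.

(** The sign condition on [V] is guarded by [0 < n] because, without users, no variance forces
    it. *)
Lemma central_le_local (R : realType) (n : nat) (V : R) (psi : 'I_n -> R) :
  ((0 < n)%N -> 0 <= V) -> (forall i, 0 <= psi i) ->
  (optimal_value (central_objective V psi)
   <= optimal_value (local_objective V psi))%E.
Proof.
move=> V0 psi0; apply: le_ereal_inf_tmp => _ [y y0 <-].
have [yn0|/forallNP yz] := pselect (exists i, y i != 0); last first.
  (* At [y = 0], which covers [n = 0], all weights vanish and the local objective is [+oo]. *)
  rewrite /local_objective big1 => [|i _]; last first.
    have /negP/negPn/eqP -> := yz i.
    by rewrite local_weightE ?V0 ?(leq_ltn_trans _ (ltn_ord i))// expr0n/= mul0r.
  by rewrite inver eqxx gt0_muley ?lte_fin// addye// leey.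
have {}V0 : 0 <= V by case: yn0 => i _; rewrite V0// (leq_ltn_trans _ (ltn_ord i)).
have [z [zy z0 S0 zS]] := central_budget _ _ _ _ V0 y0 yn0.
apply: ge_ereal_inf; exists (central_objective V psi z).
  by exists z => // i; case/andP: (zy i).
rewrite /central_objective /local_objective.
rewrite (eq_bigr _ (fun i _ => local_weightE _ _ (y i) V0)) sumEFin.
(* Both denominators are positive, so both objectives are finite; errors and payments are compared
   separately. *)
rewrite !inver !gt_eqF ?exprn_gt0// -!EFinM -!EFinD lee_fin lerD//.
  by rewrite -mulrA ler_wpM2l// mulrC.
by apply: ler_sum => i _; case/andP: (zy i) => _; exact: ler_wpM2l.
Qed.

Theorem corollary3 (R : realType) (d : measure_display) (T : measurableType d)
    (P : probability T R) (n : nat)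
    (X : 'I_n -> {RV P >-> R}) (VAR : R)
    (hVAR : forall i, 'V_P[X i] = VAR%:E)
    (C : 'I_n -> {RV P >-> R}) (f : 'I_n -> R -> R)
    (hf : forall i, is_density (C i) (f i))
    (c : 'I_n -> R)
    (c_ge0 : forall i, 0 <= c i)
    (fc_neq0 : forall i, f i (c i) <> 0) :
  let psi := fun i => virtual_cost (C i) (f i) (c i) in
  (optimal_value (central_objective VAR psi)
   <= optimal_value (local_objective VAR psi))%E.
Proof.
apply: central_le_local => [n0|i].
  by rewrite -lee_fin -(hVAR (Ordinal n0)) variance_ge0.
by have [_ f0 _] := hf i; exact: virtual_cost_ge0.
Qed.
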